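(* Let $p$ be an odd prime, $n\ge 1$, $1\le k\le n$ and $i\ge 1$. Then $$\gamma_i(W_n)\cap B_k=\langle x^\Lambda\Delta_k \mid \mathrm{pdeg}(x^\Lambda\Delta_k)\le p^{n-1}-i\rangle ,$$ where $x^\Lambda\Delta_k$ ranges over the power monomials in $B_k$.
   Context: Let $p$ be an odd prime and $n\ge 1$ an integer. For $1\le k\le n$ let $B_k=\mathrm{Fun}(\mathbb{F}_p^{k-1},\mathbb{F}_p)$ (additive group; $B_1=\mathbb{F}_p$), whose elements are identified with polynomials over $\mathbb{F}_p$ in $x_1,\dots,x_{k-1}$ with degree at most $p-1$ in each variable (products are reduced by $x_i^p=x_i$). Write $f\Delta_k$ for $f$ regarded as an element of $B_k$. The element $f\Delta_k$ acts on $\mathbb{F}_p^n$ as the permutation $x\mapsto x-f(x_1,\dots,x_{k-1})e_k$. $W_n$ is the subgroup of $\mathrm{Sym}(\mathbb{F}_p^n)$ generated by $B_1,\dots,B_n$ (the $n$-fold iterated wreath product of $\mathbb{F}_p$, a Sylow $p$-subgroup of $\mathrm{Sym}(p^n)$). $\gamma_1(W_n)=W_n$, $\gamma_{i+1}(W_n)=[\gamma_i(W_n),W_n]$. A power monomial in $B_k$ is an element $x^\Lambda\Delta_k$ with $x^\Lambda=x_1^{\lambda_1}\cdots x_{k-1}^{\lambda_{k-1}}$, $0\le\lambda_i\le p-1$. Its $p$-degree is $\mathrm{pdeg}(x^\Lambda\Delta_k)=\mathrm{pdeg}(x^\Lambda)+\mu_k$, where $\mathrm{pdeg}(x^\Lambda)=\sum_{i=1}^{k-1}\lambda_i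 p^{i-1}$ and $\mu_k=p^{n-1}-p^{k-1}$. *)

(* Defs.v *)
From HB Require Import structures.
From mathcomp Require Import all_boot all_order all_algebra all_fingroup all_solvable.
Set Implicit Arguments. Unset Strict Implicit. Unset Printing Implicit Defensive.
Import GRing.Theory.

Local Open Scope ring_scope.

(* Coordinates and levels are counted from 0: the index k : 'I_n stands for    *)
(* the level k.+1 of the wreath product, so that the base group of that level  *)
(* consists of the functions of the k coordinates x 0 j with j < k.            *)

Section Wreath.

Variables (p n : nat).

Definition trunc (k : 'I_n) (x : 'rV['F_p]_n) : 'rV['F_p]_k :=
  \row_(j < k) x 0 (widen_ord (ltnW (ltn_ord k)) j).

Definition shift (k : 'I_n) (f : {ffun 'rV['F_p]_k -> 'F_p})
    (x : 'rV['F_p]_n) : 'rV['F_p]_n :=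
  x - f (trunc k x) *: delta_mx 0 k.

Lemma trunc_shift (k : 'I_n) (f : {ffun 'rV['F_p]_k -> 'F_p}) x :
  trunc k (shift f x) = trunc k x.
Proof.
apply/rowP => j; rewrite !mxE /= [_ == k](_ : _ = false) ?mulr0 ?subr0 //.
by apply/negbTE; rewrite -val_eqE /= neq_ltn ltn_ord.
Qed.

Lemma shift_inj (k : 'I_n) (f : {ffun 'rV['F_p]_k -> 'F_p}) : injective (shift f).
Proof.
move=> x y exy; have etr : trunc k x = trunc k y.
  by rewrite -(trunc_shift f x) exy trunc_shift.
by move: exy; rewrite /shift etr => /addIr.
Qed.

Definition Delta (k : 'I_n) (f : {ffun 'rV['F_p]_k -> 'F_p}) :
    {perm 'rV['F_p]_n} := perm (@shift_inj k f).

Definition B (k : 'I_n) : {set {perm 'rV['F_p]_n}} :=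
  [set Delta f | f : {ffun 'rV['F_p]_k -> 'F_p}].

Definition W : {group {perm 'rV['F_p]_n}} := <<\bigcup_(k < n) B k>>%G.

Definition monomial (k : nat) (L : {ffun 'I_k -> 'I_p}) :
    {ffun 'rV['F_p]_k -> 'F_p} :=
  [ffun x : 'rV['F_p]_k => \prod_(j < k) x 0 j ^+ L j].

Definition pdeg_mon (k : nat) (L : {ffun 'I_k -> 'I_p}) : nat :=
  (\sum_(j < k) L j * p ^ j)%N.

(* The subtraction is never truncated, since k <= n.-1.                        *)
Definition mu (k : 'I_n) : nat := (p ^ n.-1 - p ^ k)%N.

Definition pdeg (k : 'I_n) (L : {ffun 'I_k -> 'I_p}) : nat :=
  (pdeg_mon L + mu k)%N.

End Wreath.

Arguments B p {n} k.
Arguments mu p {n} k.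

(* Main.v *)
Require Import Defs.
From HB Require Import structures.
From mathcomp Require Import all_boot all_order all_algebra all_fingroup all_solvable.
From mathcomp Require Import finfield ring zify.

(** Number the power monomials of F_p[x_0, ..., x_{n-1}] by their p-degree: [mono N] is
    the monomial whose exponents are the base-p digits of N.  Let V_m be the
    span of the monomials number 0, ..., m-1.  The base group at level k is the
    space of functions of the first k coordinates, which is V_{p^k}, and,
    because mu_k = p^(n-1) - p^k, the theorem says that the i-th term of
    the lower central series meets it exactly in V_{p^k + 1 - i}.  Everything
    follows from the action of W on the single flag V_0, V_1, ..., V_{p^n}.

    Upper bound.  W acts unitriangularly on the flag: w - 1 maps V_m into
    V_{m-1} ([W_lowers]).  The elements w for which w - 1 maps V_m into
    V_{m-i} for all m therefore satisfy the usual commutator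
    rule ([lowersR]), so the i-th term of the lower central series lowers the
    flag by i steps ([lcn_lowers]).  The coordinate x_k is the
    monomial number p^k, hence lies in V_{p^k + 1}, and the base element given by f
    moves it by -f; so f must lie in V_{p^k + 1 - i} ([Delta_lcn_in_flag]).

    Lower bound.  For 0 < N < p^n some generator of W, at a level j with
    p^j <= N, sends [mono N] to itself plus a nonzero multiple of [mono N.-1]
    plus lower terms ([mono_shift_pred]).  Commuting a base element f of level k > j with
    the inverse of that generator replaces f by the difference of its
    translate and itself ([Delta_commg]).  Starting from the top monomial number
    p^k - 1, this yields in the i-th term of the series an element with leading
    monomial p^k - i ([lcn_leading]), and elements with all leading monomials
    below m span V_m ([Delta_triangular]). *)

Local Open Scope group_scope.

Lemma gen_ind (gT : finGroupType) (A : {set gT}) (P : gT -> Prop) :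
  P 1%g -> (forall x y, P x -> P y -> P (x * y)%g) ->
  (forall x, x \in A -> P x) -> forall x, x \in <<A>>%g -> P x.
Proof.
move=> P1 PM PA x /gen_prodgP[s [c cA ->]].
by apply: big_ind => // i _; apply: PA.
Qed.

Section LowerCentralSeries.

Set Implicit Arguments. Unset Strict Implicit. Unset Printing Implicit Defensive.
Import GRing.Theory.
Local Open Scope ring_scope.

Variables (p n : nat).
Hypothesis p_pr : prime p.

Let expp_gt0 k : (0 < p ^ k)%N. Proof. by rewrite expn_gt0 prime_gt0. Qed.

(** * Base-p digits *)

Definition digit (j N : nat) : nat := ((N %/ p ^ j) %% p)%N.

Lemma digit_lt j N : (digit j N < p)%N.
Proof. by rewrite ltn_pmod ?prime_gt0. Qed.

Lemma digit_small j N : (N < p ^ j)%N -> digit j N = 0%N.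
Proof. by move=> h; rewrite /digit divn_small ?mod0n. Qed.

Lemma digit_mull j k q : (j < k)%N -> digit j (q * p ^ k) = 0%N.
Proof.
move=> /subnKC <-; rewrite /digit addSn expnS expnD.
have -> : (q * (p * (p ^ j * p ^ (k - j.+1))) = q * p ^ (k - j.+1) * p * p ^ j)%N by ring.
by rewrite mulnK ?expp_gt0 // modnMl.
Qed.

Lemma digitD j k r q : (r < p ^ k)%N ->
  digit j (r + q * p ^ k) = (digit j r + digit j (q * p ^ k))%N.
Proof.
move=> r_lt; case: (ltnP j k) => [jk | kj].
  rewrite digit_mull // addn0 /digit -(subnKC jk) addSn expnS expnD.
  set t := (p ^ j)%N; set s := (p ^ _)%N.
  have -> : (r + q * (p * (t * s)) = q * s * p * t + r)%N by ring.
  by rewrite divnMDl ?expp_gt0 // modnMDl.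
rewrite [digit j r]digit_small ?add0n; last first.
  by apply: leq_trans r_lt _; rewrite leq_exp2l ?prime_gt1.
rewrite /digit.
rewrite -(subnKC kj) expnD !divnMA mulnK ?expp_gt0 // addnC divnMDl ?expp_gt0 //.
by rewrite [(r %/ _)%N]divn_small ?addn0.
Qed.

Lemma digit_mul_exp j k a : (a < p)%N -> digit j (a * p ^ k) = ((j == k) * a)%N.
Proof.
move=> a_lt; case: ltngtP => [jk | kj | ->]; first by rewrite digit_mull.
  rewrite digit_small // -(subnKC kj) addSn expnS expnD mulnA.
  by rewrite (leq_trans (n := p * p ^ k)%N) ?ltn_pmul2r // leq_pmulr.
by rewrite /digit mulnK ?expp_gt0 // modn_small // mul1n.
Qed.

Lemma sum_digit k N : (N < p ^ k)%N -> (\sum_(j < k) digit j N * p ^ j = N)%N.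
Proof.
have step : (\sum_(j < k) digit j N * p ^ j = N %% p ^ k)%N.
  elim: k => [|k IH]; first by rewrite big_ord0 modn1.
  rewrite big_ord_recr /= IH expnSr; set u := (N %% _)%N; set v := digit k N.
  have -> : (N = N %/ p ^ k %/ p * (p ^ k * p) + (u + v * p ^ k))%N.
    by rewrite {1}(divn_eq N (p ^ k)) {1}(divn_eq (N %/ p ^ k) p) -/u -/v; ring.
  rewrite modnMDl [RHS]modn_small //.
  have := digit_lt k N; have := ltn_pmod N (expp_gt0 k); rewrite -/u -/v.
  by move: (p ^ k)%N => w; nia.
by move=> N_lt; rewrite step modn_small.
Qed.

Lemma sum_digit_lt k (d : nat -> nat) : (forall j, d j < p)%N ->
  (\sum_(j < k) d j * p ^ j < p ^ k)%N.
Proof.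
move=> d_lt; elim: k => [|k IH]; first by rewrite big_ord0.
rewrite big_ord_recr /= expnS; have := d_lt k.
by move: IH (expp_gt0 k); move: (\sum_(_ < _) _)%N (p ^ k)%N => u v; nia.
Qed.

Lemma digit_sum k (d : nat -> nat) : (forall j, d j < p)%N ->
  forall i, (i < k)%N -> digit i (\sum_(j < k) d j * p ^ j) = d i.
Proof.
move=> d_lt; elim: k => // k IH i; rewrite ltnS => ik.
rewrite big_ord_recr /= digitD ?sum_digit_lt // digit_mul_exp ?d_lt //.
move: ik; rewrite leq_eqVlt => /predU1P[-> | ik].
  by rewrite eqxx digit_small ?sum_digit_lt // mul1n.
by rewrite IH // ltn_eqF // addn0.
Qed.

(** * The flag of monomials ordered by p-degree *)

Definition mono (N : nat) (x : 'rV['F_p]_n) : 'F_p :=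
  \prod_(j < n) x 0 j ^+ digit j N.

Lemma eq_mono N (x y : 'rV['F_p]_n) :
  (forall j : 'I_n, digit j N != 0%N -> x 0 j = y 0 j) -> mono N x = mono N y.
Proof.
move=> exy; apply: eq_bigr => j _.
by case: (eqVneq (digit j N) 0%N) => [-> // | /exy ->].
Qed.

Lemma monoD k r q x : (r < p ^ k)%N ->
  mono (r + q * p ^ k) x = mono r x * mono (q * p ^ k) x.
Proof.
move=> r_lt; rewrite /mono -big_split; apply: eq_bigr => j _.
by rewrite digitD // exprD.
Qed.

Lemma mono_pow (k : 'I_n) a (x : 'rV['F_p]_n) : (a < p)%N ->
  mono (a * p ^ k) x = x 0 k ^+ a.
Proof.
move=> a_lt; rewrite /mono (bigD1 k) //= digit_mul_exp // eqxx mul1n big1 ?mulr1 //.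
by move=> j jk; rewrite digit_mul_exp // [(_ == _)%N](negPf jk).
Qed.

Lemma mono_split (k : 'I_n) r a q (x : 'rV['F_p]_n) : (r < p ^ k)%N -> (a < p)%N ->
  mono (r + a * p ^ k + q * p ^ k.+1) x
    = mono r x * x 0 k ^+ a * mono (q * p ^ k.+1) x.
Proof.
move=> r_lt a_lt; rewrite monoD ?monoD ?mono_pow //.
by rewrite expnS; move: r_lt a_lt; move: (p ^ k)%N => u; nia.
Qed.

(** Membership in the flag space V_m. *)
Definition in_flag (m : nat) (phi : 'rV['F_p]_n -> 'F_p) : Prop :=
  exists c : nat -> 'F_p, forall x, phi x = \sum_(N < m) c N * mono N x.

Lemma in_flag_eq m phi psi : (forall x, phi x = psi x) -> in_flag m phi -> in_flag m psi.
Proof. by move=> e [c hc]; exists c => x; rewrite -e. Qed.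

Lemma in_flag_zero m : in_flag m (fun=> 0).
Proof. by exists (fun=> 0) => x; rewrite big1 // => N _; rewrite mul0r. Qed.

Lemma in_flag_add m phi psi : in_flag m phi -> in_flag m psi ->
  in_flag m (fun x => phi x + psi x).
Proof.
move=> [c hc] [d hd]; exists (fun N => c N + d N) => x; rewrite hc hd -big_split.
by apply: eq_bigr => N _; rewrite mulrDl.
Qed.

Lemma in_flag_scale m a phi : in_flag m phi -> in_flag m (fun x => a * phi x).
Proof.
move=> [c hc]; exists (fun N => a * c N) => x; rewrite hc mulr_sumr.
by apply: eq_bigr => N _; rewrite mulrA.
Qed.

Lemma in_flag_sub m phi psi : in_flag m phi -> in_flag m psi ->
  in_flag m (fun x => phi x - psi x).
Proof.
move=> h1 /(in_flag_scale (-1)) h2; apply: in_flag_eq (in_flag_add h1 h2) => x.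
by rewrite mulN1r.
Qed.

Lemma in_flag_sum m I (r : seq I) (P : pred I) (phi : I -> 'rV['F_p]_n -> 'F_p) :
  (forall i, P i -> in_flag m (phi i)) ->
  in_flag m (fun x => \sum_(i <- r | P i) phi i x).
Proof.
move=> h; elim: r => [|i r IH].
  by apply: in_flag_eq (in_flag_zero m) => x; rewrite big_nil.
case Pi: (P i); last by apply: in_flag_eq IH => x; rewrite big_cons Pi.
by apply: in_flag_eq (in_flag_add (h i Pi) IH) => x; rewrite big_cons Pi.
Qed.

Lemma in_flag_mono m N : (N < m)%N -> in_flag m (mono N).
Proof.
move=> N_lt; exists (fun M => (M == N)%:R) => x.
rewrite (bigD1 (Ordinal N_lt)) //= eqxx mul1r big1 ?addr0 // => M /negPf.
by rewrite -val_eqE /= => ->; rewrite mul0r.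
Qed.

Lemma in_flag_le m m' phi : (m <= m')%N -> in_flag m phi -> in_flag m' phi.
Proof.
move=> le_mm' [c hc].
apply: (@in_flag_eq _ (fun x => \sum_(N < m) c N * mono N x)) => [x|].
  by rewrite hc.
apply: in_flag_sum => N _; apply/in_flag_scale/in_flag_mono.
exact: leq_trans (ltn_ord N) le_mm'.
Qed.

(** Multiplying by a monomial in the coordinates from k on shifts the whole
    block of monomials in the first k coordinates: base-p addition
    without carries. *)
Lemma in_flag_block k q h : in_flag (p ^ k) h ->
  in_flag (q.+1 * p ^ k) (fun x => h x * mono (q * p ^ k) x).
Proof.
move=> [c hc].
apply: (@in_flag_eq _ (fun x => \sum_(N < p ^ k) c N * mono (N + q * p ^ k) x)) => [x|].
  by rewrite hc mulr_suml; apply: eq_bigr => N _; rewrite monoD ?mulrA.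
apply: in_flag_sum => N _; apply/in_flag_scale/in_flag_mono.
by rewrite mulSn ltn_add2r.
Qed.

(** The indicator of [a] is 1 - (y - a)^(p-1), by Fermat. *)
Lemma Fp_interpolation : exists d : 'F_p -> nat -> 'F_p,
  forall a y : 'F_p, \sum_(b < p) d a b * y ^+ b = (y == a)%:R.
Proof.
pose P (a : 'F_p) : {poly 'F_p} := 1 - ('X - a%:P) ^+ p.-1.
have p_gt1 := prime_gt1 p_pr.
exists (fun a b => (P a)`_b) => a y; rewrite -horner_coef_wide; last first.
  rewrite /P (leq_trans (size_polyD _ _)) // size_polyN size_poly1 geq_max.
  by rewrite size_exp_XsubC prednK ?prime_gt0 // leqnn.
rewrite /P !hornerE; case: eqP => [-> | /eqP ya].
  by rewrite subrr expr0n -subn1 subn_eq0 leqNgt p_gt1 subr0.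
suff -> : (y - a) ^+ p.-1 = 1 by rewrite subrr.
have ya0 : y - a != 0 by rewrite subr_eq0.
apply: (mulfI ya0); rewrite mulr1 -exprS prednK ?prime_gt0 //.
by have := expf_card (y - a); rewrite card_Fp.
Qed.

Lemma mono0 x : mono 0 x = 1.
Proof. by rewrite /mono big1 // => j _; rewrite digit_small ?expp_gt0. Qed.

Definition depends_below (k : nat) (phi : 'rV['F_p]_n -> 'F_p) : Prop :=
  forall x y : 'rV['F_p]_n, (forall j : 'I_n, (j < k)%N -> x 0 j = y 0 j) ->
  phi x = phi y.

(** Every function of the first k coordinates is a reduced polynomial in them:
    interpolate in the last of these coordinates and recurse. *)
Lemma depends_in_flag k phi : (k <= n)%N -> depends_below k phi -> in_flag (p ^ k) phi.
Proof.
elim: k phi => [|k IH] phi k_le dep_phi.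
  apply: (@in_flag_eq _ (fun x => phi 0 * mono 0 x)) => [x|].
    by rewrite mono0 mulr1; apply: dep_phi.
  exact/in_flag_scale/in_flag_mono/expp_gt0.
pose kk := Ordinal k_le; have [d hd] := Fp_interpolation.
pose upd a (x : 'rV['F_p]_n) : 'rV['F_p]_n := \row_j (if j == kk then a else x 0 j).
have dep_upd a : depends_below k (fun x => phi (upd a x)).
  move=> x y exy; apply: dep_phi => j; rewrite ltnS leq_eqVlt !mxE -val_eqE /=.
  by case: eqP => //= _; apply: exy.
apply: (@in_flag_eq _ (fun x => \sum_a \sum_(b < p)
    d a b * (phi (upd a x) * mono (b * p ^ k) x))) => [x|].
  transitivity (\sum_a phi (upd a x) * (x 0 kk == a)%:R).
    apply: eq_bigr => a _; rewrite -hd mulr_sumr; apply: eq_bigr => b _.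
    by rewrite (mono_pow kk) // mulrCA mulrA.
  rewrite (bigD1 (x 0 kk)) //= eqxx mulr1 big1 ?addr0 => [|a /negPf].
    by congr phi; apply/rowP => j; rewrite mxE; case: eqP => [->|].
  by rewrite eq_sym => ->; rewrite mulr0.
apply: in_flag_sum => a _; apply: in_flag_sum => b _; apply: in_flag_scale.
apply: in_flag_le (in_flag_block _ (IH _ (ltnW k_le) (dep_upd a))).
by rewrite expnS leq_mul2r ltn_ord orbT.
Qed.

Lemma depends_comp_trunc (k : 'I_n) (f : {ffun 'rV['F_p]_k -> 'F_p}) :
  depends_below k (fun x => f (trunc k x)).
Proof.
by move=> x y exy; congr (f _); apply/rowP => j; rewrite !mxE exy /=.
Qed.

Lemma shift_neq (k : 'I_n) (f : {ffun 'rV['F_p]_k -> 'F_p}) (x : 'rV['F_p]_n) j :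
  j != k -> shift f x 0 j = x 0 j :> 'F_p.
Proof. by move=> jk; rewrite !mxE eqxx (negPf jk) mulr0 subr0. Qed.

Lemma shift_eq (k : 'I_n) (f : {ffun 'rV['F_p]_k -> 'F_p}) (x : 'rV['F_p]_n) :
  shift f x 0 k = x 0 k - f (trunc k x) :> 'F_p.
Proof. by rewrite !mxE !eqxx mulr1. Qed.

Lemma mono_depends k r : (r < p ^ k)%N -> depends_below k (mono r).
Proof.
move=> r_lt x y exy; apply: eq_mono => j; case: (ltnP j k) => [/exy // | kj].
by rewrite digit_small // (leq_trans r_lt) // leq_exp2l ?prime_gt1.
Qed.

(** Only the k-th factor of the monomial is moved; this is the binomial expansion of
    (x_k - f)^a without its leading term. *)
Lemma mono_shift_sub (k : 'I_n) (f : {ffun 'rV['F_p]_k -> 'F_p}) r a q x :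
  (r < p ^ k)%N -> (a < p)%N ->
  mono (r + a * p ^ k + q * p ^ k.+1) (shift f x)
      - mono (r + a * p ^ k + q * p ^ k.+1) x
    = \sum_(i < a) (mono r x * (- f (trunc k x)) ^+ i.+1)
                    * mono ((a - i.+1 + q * p) * p ^ k) x *+ 'C(a, i.+1).
Proof.
move=> r_lt a_lt.
rewrite !mono_split // shift_eq exprDn.
rewrite (mono_depends r_lt (x := shift f x) (y := x)) => [|j jk]; last first.
  by rewrite shift_neq // -val_eqE ltn_eqF.
rewrite (eq_mono (x := shift f x) (y := x) (N := (q * p ^ k.+1)%N)) => [|j]; last first.
  case: (ltngtP k j) => [kj _ | jk | /val_inj <-].
  - by rewrite shift_neq // -val_eqE /= gtn_eqF.
  - by rewrite digit_mull // ltnW.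
  - by rewrite digit_mull.
rewrite big_ord_recl /= subn0 expr0 mulr1 bin0 mulr1n mulrDr mulrDl addrC addKr.
rewrite mulr_sumr mulr_suml; apply: eq_bigr => i _.
have -> : ((a - i.+1 + q * p) * p ^ k = 0 + (a - i.+1) * p ^ k + q * p ^ k.+1)%N.
  by rewrite expnS; ring.
rewrite mono_split ?expp_gt0 //; last by rewrite (leq_ltn_trans _ a_lt) // leq_subr.
rewrite mono0 mul1r mulrnAr mulrnAl; congr (_ *+ _).
by rewrite -!mulrA; congr (_ * _); rewrite mulrCA.
Qed.

(** The first factor depends on the first k coordinates only, so whatever its
    degree it stays inside one block of length p^k. *)
Lemma in_flag_shift_term (k : 'I_n) (f : {ffun 'rV['F_p]_k -> 'F_p}) r e q i :
  (r < p ^ k)%N ->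
  in_flag ((e + q * p).+1 * p ^ k)
    (fun x => (mono r x * (- f (trunc k x)) ^+ i) * mono ((e + q * p) * p ^ k) x).
Proof.
move=> r_lt; apply: (@in_flag_block k _ (fun x => mono r x * (- f (trunc k x)) ^+ i)).
apply: depends_in_flag (ltnW (ltn_ord k)) _ => x y exy.
by rewrite (mono_depends r_lt exy) (depends_comp_trunc f exy).
Qed.

Lemma digit_split k N :
  N = (N %% p ^ k + digit k N * p ^ k + N %/ p ^ k.+1 * p ^ k.+1)%N.
Proof.
rewrite [(p ^ k.+1)%N]expnSr divnMA {1}(divn_eq N (p ^ k)) {1}(divn_eq (N %/ p ^ k) p).
by rewrite -/(digit k N); ring.
Qed.

(** Unitriangularity: every term of the binomial expansion has a smaller
    exponent of x_k, a digit that outweighs all those below it. *)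
Lemma in_flag_mono_shift (k : 'I_n) (f : {ffun 'rV['F_p]_k -> 'F_p}) N :
  in_flag N (fun x => mono N (shift f x) - mono N x).
Proof.
have r_lt : (N %% p ^ k < p ^ k)%N by rewrite ltn_pmod.
have := digit_split k N; have := digit_lt k N.
move: (N %% _)%N (digit k N) (N %/ _)%N r_lt => r a q r_lt a_lt ->.
apply: in_flag_eq => [x|]; first by rewrite mono_shift_sub.
apply: in_flag_sum => i _; apply: in_flag_eq => [x|]; first by rewrite -mulr_natl.
apply: in_flag_scale; apply: in_flag_le (in_flag_shift_term f _ _ _ r_lt).
have ia := ltn_ord i; rewrite expnS.
suff : ((a - i.+1 + q * p).+1 * p ^ k <= (a + q * p) * p ^ k)%N.
  by rewrite mulnDl mulnA; lia.
by rewrite leq_mul2r; apply/orP; right; lia.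
Qed.

Lemma in_flag_sub_mono m (w : 'rV['F_p]_n -> 'rV['F_p]_n) phi :
  (forall N, in_flag N (fun x => mono N (w x) - mono N x)) ->
  in_flag m phi -> in_flag (m - 1) (fun x => phi (w x) - phi x).
Proof.
move=> hw [c hc].
apply: (@in_flag_eq _ (fun x => \sum_(N < m) c N * (mono N (w x) - mono N x))) => [x|].
  by rewrite !hc -sumrB; apply: eq_bigr => N _; rewrite mulrBr.
apply: in_flag_sum => N _; apply: in_flag_scale; apply: in_flag_le (hw N).
by have := ltn_ord N; lia.
Qed.

(** * The lower central series lowers the flag *)

(** The subtraction is truncated on purpose: when m <= i the elements in question
    fix every function of V_m. *)
Definition lowers i (w : {perm 'rV['F_p]_n}) : Prop :=
  forall m phi, in_flag m phi -> in_flag (m - i) (fun x => phi (w x) - phi x).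

Lemma lowers_stable i w m phi : lowers i w -> in_flag m phi ->
  in_flag m (fun x => phi (w x)).
Proof.
move=> hw hphi; have h := in_flag_le (leq_subr i m) (hw _ _ hphi).
apply: in_flag_eq (in_flag_add h hphi) => x.
by rewrite subrK.
Qed.

Lemma lowers1 i : lowers i 1%g.
Proof.
by move=> m phi _; apply: in_flag_eq (in_flag_zero _) => x; rewrite perm1 subrr.
Qed.

Lemma lowersM i u v : lowers i u -> lowers i v -> lowers i (u * v)%g.
Proof.
move=> hu hv m phi hphi.
have h1 := hu _ _ (lowers_stable hv hphi); have h2 := hv _ _ hphi.
by apply: in_flag_eq (in_flag_add h1 h2) => x; rewrite permM addrA subrK.
Qed.

(** In a finite group the inverse is a power. *)
Lemma lowersV i u : lowers i u -> lowers i u^-1%g.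
Proof.
move=> hu; rewrite -[u^-1%g]mulg1 -(expg_order u) -[#[u]%g]prednK ?order_gt0 //.
rewrite expgS mulKg; elim: #[u]%g.-1 => [|s IH]; first by rewrite expg0; apply: lowers1.
by rewrite expgS; apply: lowersM.
Qed.

(** As operators, uw - wu = (u - 1)(w - 1) - (w - 1)(u - 1) lowers by i + 1, and
    [u, w] - 1 is this difference followed by an invertible operator preserving
    the flag. *)
Lemma lowersR i u w : lowers i u -> lowers 1 w -> lowers i.+1 [~ u, w]%g.
Proof.
move=> hu hw m phi hphi.
have hd : in_flag (m - i.+1) (fun x => phi (w (u x)) - phi (u (w x))).
  have h1 := hw _ _ (hu _ _ hphi); have h2 := hu _ _ (hw _ _ hphi).
  rewrite -subnDA addn1 in h1; rewrite -subnDA add1n in h2.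
  by apply: in_flag_eq (in_flag_sub h2 h1) => x; ring.
have := lowers_stable (lowersV hu) (lowers_stable (lowersV hw) hd).
by apply: in_flag_eq => x; rewrite commgEl conjgE !permM !permKV.
Qed.

Lemma W_lowers w : w \in W p n -> lowers 1 w.
Proof.
apply: gen_ind; [exact: lowers1 | exact: lowersM | move=> {}w].
case/bigcupP => k _ /imsetP[f _ ->] m phi; apply: in_flag_sub_mono => N.
by apply: in_flag_eq (in_flag_mono_shift f N) => x; rewrite permE.
Qed.

Lemma lcn_lowers i w : w \in ('L_i.+1(W p n))%g -> lowers i.+1 w.
Proof.
elim: i w => [|i IH] w; first by rewrite lcn1; apply: W_lowers.
rewrite lcnSn; apply: gen_ind; [exact: lowers1 | exact: lowersM | move=> {}w].
by case/imset2P => u v /IH hu /W_lowers hv ->; apply: lowersR.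
Qed.

(** Apply [lcn_lowers] to the coordinate x_k, which is [mono (p ^ k)]. *)
Lemma Delta_lcn_in_flag (k : 'I_n) (f : {ffun 'rV['F_p]_k -> 'F_p}) i :
  Delta f \in ('L_i.+1(W p n))%g ->
  in_flag (p ^ k - i) (fun x => f (trunc k x)).
Proof.
move=> /lcn_lowers hf.
have hX : in_flag (p ^ k).+1 (mono (1 * p ^ k)) by rewrite mul1n; apply: in_flag_mono.
have := in_flag_scale (-1) (hf _ _ hX); rewrite subSS; apply: in_flag_eq => x.
by rewrite !mono_pow ?prime_gt1 // permE shift_eq; ring.
Qed.

(** * Base elements as functions on the first k coordinates *)

Definition digits k N : {ffun 'I_k -> 'I_p} := [ffun j : 'I_k => Ordinal (digit_lt j N)].

Lemma mono_trunc (k : 'I_n) N x : (N < p ^ k)%N ->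
  mono N x = monomial (digits k N) (trunc k x).
Proof.
move=> N_lt; rewrite /mono ffunE (bigID (fun j : 'I_n => (j < k)%N)) /= mulrC big1 ?mul1r.
  rewrite (big_ord_narrow (ltnW (ltn_ord k))).
  by apply: eq_bigr => j _; rewrite mxE ffunE.
move=> j; rewrite -leqNgt => kj.
by rewrite digit_small // (leq_trans N_lt) // leq_exp2l ?prime_gt1.
Qed.

Lemma pdeg_digits k N : (N < p ^ k)%N -> pdeg_mon (digits k N) = N.
Proof.
by move=> /sum_digit {2}<-; apply: eq_bigr => j _; rewrite ffunE.
Qed.

Lemma digits_pdeg k (L : {ffun 'I_k -> 'I_p}) :
  (pdeg_mon L < p ^ k)%N /\ digits k (pdeg_mon L) = L.
Proof.
pose d j : nat := if insub j is Some i then L i else 0%N.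
have dE (j : 'I_k) : d j = L j by rewrite /d valK.
have eL : pdeg_mon L = (\sum_(j < k) d j * p ^ j)%N.
  by apply: eq_bigr => j _; rewrite dE.
have d_lt j : (d j < p)%N by rewrite /d; case: insubP => // _; rewrite prime_gt0.
rewrite eL sum_digit_lt //; split=> //.
by apply/ffunP => j; apply: val_inj; rewrite ffunE /= digit_sum.
Qed.

Lemma in_flag_trunc (k : 'I_n) phi m : (m <= p ^ k)%N -> in_flag m phi ->
  exists f : {ffun 'rV['F_p]_k -> 'F_p}, forall x, f (trunc k x) = phi x.
Proof.
move=> m_le [c hc]; exists [ffun y => \sum_(N < m) c N * monomial (digits k N) y] => x.
rewrite ffunE hc; apply: eq_bigr => N _; rewrite -mono_trunc //.
exact: leq_trans (ltn_ord N) m_le.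
Qed.

Lemma trunc_surj (k : 'I_n) (y : 'rV['F_p]_k) : exists x : 'rV['F_p]_n, trunc k x = y.
Proof.
exists (\row_j if insub (val j) is Some i then y 0 i else 0).
by apply/rowP => j; rewrite !mxE /= valK.
Qed.

Lemma Delta_add (k : 'I_n) (f g h : {ffun 'rV['F_p]_k -> 'F_p}) :
  (forall y, h y = f y + g y) -> Delta h = (Delta f * Delta g)%g.
Proof.
move=> hE; apply/permP => x.
by rewrite permM !permE /= {2}/shift trunc_shift /shift hE scalerDl opprD addrA.
Qed.

Lemma Delta_scale (k : 'I_n) (f h : {ffun 'rV['F_p]_k -> 'F_p}) (a : nat) :
  (forall y, h y = a%:R * f y) -> Delta h = (Delta f ^+ a)%g.
Proof.
elim: a h => [|a IH] h hE.
  apply/permP => x; rewrite expg0 perm1 permE /shift hE mul0r scale0r subr0 //.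
rewrite expgS -(IH [ffun y => a%:R * f y]) => [|y]; last by rewrite ffunE.
by apply: Delta_add => y; rewrite hE ffunE mulrS mulrDl mul1r.
Qed.

(** As j < k, the shift at level j commutes with translations along the k-th
    coordinate, so conjugating by it only substitutes it into f. *)
Lemma Delta_commg (j k : 'I_n) (g : {ffun 'rV['F_p]_j -> 'F_p})
    (f h : {ffun 'rV['F_p]_k -> 'F_p}) : (j < k)%N ->
  (forall x, h (trunc k x) = f (trunc k (shift g x)) - f (trunc k x)) ->
  Delta h = [~ Delta f, (Delta g)^-1]%g.
Proof.
move=> jk hE.
have trunc_e a (x : 'rV['F_p]_n) : trunc j (x - a *: delta_mx 0 k) = trunc j x.
  apply/rowP => i; rewrite !mxE [_ == k]negbTE ?andbF ?mulr0 ?subr0 //.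
  by rewrite -val_eqE /= ltn_eqF // (ltn_trans (ltn_ord i)).
apply: (mulgI (Delta f)); rewrite commgEl mulKVg conjgE invgK.
apply: (mulIg (Delta g)); rewrite -!mulgA mulVg mulg1; apply/permP => x.
rewrite !permM !permE {2}/shift trunc_shift hE /shift.
rewrite -![x - _ - _]addrA -opprD -scalerDl [_ + (_ - _)]addrC subrK trunc_e.
by rewrite addrA addrAC.
Qed.

(** * Elements with prescribed leading monomial *)

(** Take j the position of the lowest nonzero digit of N, and shift x_j by the
    product g of all x_i^(p-1) with i < j.  If a is that digit, the linear term
    -a g x_j^(a-1) of the expansion of (x_j - g)^a lowers this digit by one and
    fills the zeros below it with p - 1: it is the predecessor of N.  The other
    terms have a still smaller digit at j. *)
Lemma mono_shift_pred (N : nat) : (0 < N)%N -> (N < p ^ n)%N ->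
  exists (j : 'I_n) (g : {ffun 'rV['F_p]_j -> 'F_p}) (c : 'F_p),
  [/\ (p ^ j <= N)%N, c != 0 &
    in_flag N.-1 (fun x => mono N (shift g x) - mono N x - c * mono N.-1 x)].
Proof.
move=> N_gt0 N_lt; have pj_le := dvdn_leq N_gt0 (pfactor_dvdnn p N).
have j_lt : (logn p N < n)%N.
  by rewrite -(ltn_exp2l _ _ (prime_gt1 p_pr)) (leq_ltn_trans pj_le).
pose j := Ordinal j_lt; have r_lt : ((p ^ j).-1 < p ^ j)%N by rewrite prednK.
have [g hg] := in_flag_trunc (leqnn _) (in_flag_mono r_lt).
have [m m_cop eN] := pfactor_coprime p_pr N_gt0.
have := digit_split j N; set q := (N %/ _)%N.
have -> : (N %% p ^ j = 0)%N by rewrite eN modnMl.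
have := digit_lt j N; have : (0 < digit j N)%N.
  rewrite /digit {1}eN mulnK ?expp_gt0 // lt0n.
  by rewrite prime_coprime // in m_cop.
case: (digit j N) => // a _ a_lt eN2.
exists j, g, (- a.+1%:R); split => //.
  by rewrite oppr_eq0 -(dvdn_pcharf (pchar_Fp p_pr)) gtnNdvd.
have eNp : N.-1 = ((p ^ j).-1 + a * p ^ j + q * p ^ j.+1)%N.
  by rewrite eN2 add0n mulSn -!addnA -{1}(prednK (expp_gt0 j)).
apply: (@in_flag_eq _ (fun x => \sum_(i < a) (mono 0 x * (- g (trunc j x)) ^+ i.+2)
          * mono ((a.+1 - i.+2 + q * p) * p ^ j) x *+ 'C(a.+1, i.+2))) => [x|].
  (* The term of index 0 in the binomial sum cancels the multiple of mono N.-1. *)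
  have -> : mono N.-1 x = mono (p ^ j).-1 x * mono ((a + q * p) * p ^ j) x.
    by rewrite -monoD // eNp expnS; congr (mono _ x); ring.
  rewrite {1 2}eN2 mono_shift_sub // big_ord_recl mono0 mul1r.
  rewrite expr1 subSS subn0 bin1 hg [1 *- _ * _]mulNr opprK mulr_natl mulNr mulNrn.
  by rewrite addrAC addNr add0r.
apply: in_flag_sum => i _; apply: in_flag_eq => [x|]; first by rewrite -mulr_natl.
apply: in_flag_scale; apply: in_flag_le (in_flag_shift_term g _ _ _ (expp_gt0 j)).
have ia := ltn_ord i; rewrite eNp expnS.
suff : ((a.+1 - i.+2 + q * p).+1 * p ^ j <= (a + q * p) * p ^ j)%N.
  by rewrite mulnDl mulnA; lia.
by rewrite leq_mul2r; apply/orP; right; lia.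
Qed.

Lemma Delta_in_W (k : 'I_n) (f : {ffun 'rV['F_p]_k -> 'F_p}) : Delta f \in W p n.
Proof. by apply/mem_gen/bigcupP; exists k => //; apply: imset_f. Qed.

(** Unitriangularity makes the lower terms of f harmless: they only
    contribute terms below the new leading monomial. *)
Lemma lcn_leading (k : 'I_n) s : (s < p ^ k)%N ->
  exists (f : {ffun 'rV['F_p]_k -> 'F_p}) (c : 'F_p),
  [/\ Delta f \in ('L_s.+1(W p n))%g, c != 0 &
    in_flag (p ^ k - s.+1) (fun x => f (trunc k x) - c * mono (p ^ k - s.+1) x)].
Proof.
elim: s => [|s IH] s_lt.
  have N_lt : (p ^ k - 1 < p ^ k)%N by rewrite subn1 prednK ?expp_gt0.
  have [f hf] := in_flag_trunc (leqnn _) (in_flag_mono N_lt).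
  exists f, 1; split; rewrite ?oner_eq0 ?lcn1 ?Delta_in_W //.
  by apply: in_flag_eq (in_flag_zero _) => x; rewrite hf mul1r subrr.
have [f [c [f_in c0 hf]]] := IH (ltnW s_lt).
set N := (p ^ k - s.+1)%N in hf *.
have N_lt : (N < p ^ k)%N by rewrite /N; lia.
have N_lt' : (N < p ^ n)%N.
  by rewrite (leq_trans N_lt) // leq_exp2l ?prime_gt1 // ltnW.
have N_gt0 : (0 < N)%N by rewrite subn_gt0.
have [j [g [c' [pj_le c'0 hN]]]] := mono_shift_pred N_gt0 N_lt'.
have jk : (j < k)%N by rewrite -(ltn_exp2l _ _ (prime_gt1 p_pr)) (leq_ltn_trans pj_le).
have hfN : in_flag N.+1 (fun x => f (trunc k x)).
  have hN1 := in_flag_scale c (in_flag_mono (ltnSn N)).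
  apply: in_flag_eq (in_flag_add (in_flag_le (leqnSn N) hf) hN1) => x.
  by rewrite subrK.
have hg := W_lowers (Delta_in_W g).
have hdiff : in_flag N (fun x => f (trunc k (Delta g x)) - f (trunc k x)).
  by have := hg _ _ hfN; rewrite subn1.
have [h hE] := in_flag_trunc (ltnW N_lt) hdiff.
exists h, (c * c'); split.
- rewrite lcnSn (Delta_commg (g := g) (f := f) jk) ?mem_commg ?groupV ?Delta_in_W //.
  by move=> x; rewrite hE permE.
- by rewrite mulf_neq0.
have -> : (p ^ k - s.+2 = N.-1)%N by rewrite -subnS.
have := hg _ _ hf; rewrite subn1 => hv.
apply: in_flag_eq (in_flag_add (in_flag_scale c hN) hv) => x.
by rewrite hE !permE; ring.
Qed.

(** Gaussian elimination: members of [G] with every possible leading monomial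
    below [m] generate all functions of flag level [m], independently of their
    lower terms. *)
Lemma Delta_triangular (G : {group {perm 'rV['F_p]_n}}) (k : 'I_n) m
    (f : {ffun 'rV['F_p]_k -> 'F_p}) :
  (forall N, (N < m)%N -> exists (f0 : {ffun 'rV['F_p]_k -> 'F_p}) (c : 'F_p),
    [/\ Delta f0 \in G, c != 0 &
      in_flag N (fun x => f0 (trunc k x) - c * mono N x)]) ->
  in_flag m (fun x => f (trunc k x)) -> Delta f \in G.
Proof.
move=> lead; elim: m f lead => [|m IH] f lead [c hc].
  rewrite (@Delta_scale _ f _ 0) ?expg0 ?group1 // => y.
  by have [x <-] := trunc_surj y; rewrite hc big_ord0 mul0r.
have [f0 [c0 [f0_in c0_neq0 hf0]]] := lead m (ltnSn m).
pose t := c m / c0.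
pose g := [ffun y => t * f0 y]; pose f1 := [ffun y => f y - g y].
have -> : Delta f = (Delta f1 * Delta g)%g.
  by apply: Delta_add => y; rewrite ffunE subrK.
have -> : Delta g = (Delta f0 ^+ t)%g.
  by apply: Delta_scale => y; rewrite ffunE natr_Zp.
apply: groupM; last exact: groupX.
apply: IH => [N N_lt|]; first exact/lead/ltnW.
have h1 : in_flag m (fun x => \sum_(N < m) c N * mono N x) by exists c.
have := in_flag_sub h1 (in_flag_scale t hf0); apply: in_flag_eq => x.
by rewrite !ffunE hc big_ord_recr /= mulrBr mulrA divfK //; ring.
Qed.

Lemma Delta_in_lcn (k : 'I_n) m (f : {ffun 'rV['F_p]_k -> 'F_p}) :
  (m <= p ^ k)%N -> in_flag m (fun x => f (trunc k x)) ->
  Delta f \in ('L_((p ^ k).+1 - m)(W p n))%g.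
Proof.
move=> m_le; apply: Delta_triangular => N N_lt.
have s_lt : (p ^ k - N.+1 < p ^ k)%N by rewrite ltn_subrL expp_gt0.
have [f0 [c0 [f0_in c0_neq0]]] := lcn_leading s_lt.
have -> : (p ^ k - (p ^ k - N.+1).+1 = N)%N by lia.
exists f0, c0; split=> //; apply: (subsetP (lcn_sub_leq _ _)) f0_in.
by lia.
Qed.

Lemma B_gen_sub (k : 'I_n) (A : {set {perm 'rV['F_p]_n}}) :
  A \subset B p k -> <<A>>%g \subset B p k.
Proof.
move=> sAB; apply/subsetP; apply: gen_ind => [|_ _ /imsetP[f _ ->] /imsetP[g _ ->]|].
- apply/imsetP; exists [ffun=> 0] => //.
  by rewrite (@Delta_scale _ [ffun=> 0] _ 0) // => y; rewrite ffunE mul0r.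
- apply/imsetP; exists [ffun y => f y + g y] => //.
  by apply/esym/Delta_add => y; rewrite ffunE.
- exact: (subsetP sAB).
Qed.

End LowerCentralSeries.

Theorem lemma3p3 (p n : nat) (p_prime : prime p) (p_odd : odd p)
    (n_ge1 : (1 <= n)%N) (k : 'I_n) (i : nat) (i_ge1 : (1 <= i)%N) :
  'L_i(W p n) :&: B p k =
    <<[set Delta (monomial L) | L : {ffun 'I_k -> 'I_p}
        & ((pdeg L)%:Z <= (p ^ n.-1)%:Z - i%:Z)%R]>>.
Proof.
have mu_le : (p ^ k <= p ^ n.-1)%N.
  by rewrite leq_exp2l ?prime_gt1 // -ltnS (ltn_predK n_ge1).
have pdegE (L : {ffun 'I_k -> 'I_p}) :
  ((pdeg L)%:Z <= (p ^ n.-1)%:Z - i%:Z)%R = (pdeg_mon L + i <= p ^ k)%N.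
  by rewrite /pdeg /mu; lia.
case: i i_ge1 pdegE => // i _ pdegE; apply/eqP; rewrite eqEsubset; apply/andP; split.
  apply/subsetP => w /setIP[w_in /imsetP[f _ ew]]; move: w_in; rewrite {w}ew => f_in.
  apply: Delta_triangular (Delta_lcn_in_flag p_prime f_in) => N N_lt.
  have N_ltk : N < p ^ k by move: N_lt; lia.
  exists (monomial (digits p_prime k N)), 1%R; split; last 1 first.
  - apply: in_flag_eq (@in_flag_zero p n N) => x.
    by rewrite -mono_trunc // GRing.mul1r GRing.subrr.
  - apply/mem_gen/imset_f; rewrite inE pdegE pdeg_digits //.
    by move: N_lt; lia.
  - exact: GRing.oner_neq0.
rewrite subsetI; apply/andP; split; last first.
  by apply: B_gen_sub => //; apply/subsetP => _ /imsetP[L _ ->]; apply: imset_f.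
rewrite gen_subG; apply/subsetP => w /imsetP[L]; rewrite inE pdegE => L_le ->.
have [L_lt eL] := digits_pdeg p_prime L.
have := @Delta_in_lcn p n p_prime k (p ^ k - i) (monomial L) (leq_subr _ _).
have -> : ((p ^ k).+1 - (p ^ k - i) = i.+1)%N by lia.
apply; apply: in_flag_eq (@in_flag_mono p n _ (pdeg_mon L) _) => [x|]; last by lia.
by rewrite -[in RHS]eL -mono_trunc.
Qed.
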